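(* Let $(\mathfrak{X},\Gamma,\Phi)$ be a nilpotent Cantor action. If the prime spectrum $\pi[\mathfrak{X},\Gamma,\Phi]$ is a finite set, then the action is stable.
   Context: A Cantor action $(\mathfrak{X},\Gamma,\Phi)$ is an action $\Phi\colon\Gamma\times\mathfrak{X}\to\mathfrak{X}$ of a countable group $\Gamma$ by homeomorphisms of a Cantor space $\mathfrak{X}$ which is minimal (every orbit is dense) and equicontinuous. It is a nilpotent Cantor action if $\Gamma$ contains a finitely generated nilpotent subgroup of finite index. A nonempty clopen $U\subset\mathfrak{X}$ is adapted if for all $g\in\Gamma$, $\Phi(g)(U)\cap U\neq\emptyset$ implies $\Phi(g)(U)=U$; its stabilizer $\Gamma_U=\{g:\Phi(g)(U)=U\}$ then has finite index in $\Gamma$. An adapted neighborhood basis at $x\in\mathfrak{X}$ is a properly decreasing sequence $U_1\supset U_2\supset\cdots$ of adapted clopen sets with $\bigcap_\ell U_\ell=\{x\}$ (such always exists). The Steinitz order of the action is the supernatural number $\xi(\mathfrak{X},\Gamma,\Phi)=\mathrm{lcm}\{[\Gamma:\Gamma_{U_\ell}]:\ell\ge1\}=\prod_p p^{\chi(p)}$ with $\chi(p)\in\{0,1,\dots,\infty\}$ (it does not depend on the choices made). The prime spectrum is $\pi[\mathfrak{X},\Gamma,\Phi]=\{p \text{ prime}:\chi(p)>0\}$. An action of a group $G$ (discrete or profinite) by homeomorphisms on a metric Cantor space $\mathfrak{X}$ is locally quasi-analytic if there is $\varepsilon>0$ such that for every nonempty open $U$ with $\mathrm{diam}(U)<\varepsilon$,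 every nonempty open $V\subset U$, and all $g_1,g_2\in G$: if $g_1|_V=g_2|_V$ then $g_1|_U=g_2|_U$. Let $\mathfrak{G}(\Phi)$ be the closure of $\Phi(\Gamma)$ in $\mathrm{Homeo}(\mathfrak{X})$ in the uniform topology (a profinite group acting on $\mathfrak{X}$). The action $(\mathfrak{X},\Gamma,\Phi)$ is stable if the action of $\mathfrak{G}(\Phi)$ on $\mathfrak{X}$ is locally quasi-analytic, and wild otherwise. *)

(* Defs.v *)
From Stdlib Require Import Reals List Arith ZArith Znumtheory.
Open Scope R_scope.

Record is_metric (X : Type) (d : X -> X -> R) : Prop := {
  metric_nonneg : forall x y, 0 <= d x y;
  metric_eq0 : forall x y, d x y = 0 <-> x = y;
  metric_sym : forall x y, d x y = d y x;
  metric_triangle : forall x y z, d x z <= d x y + d y z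
}.

Definition m_open {X : Type} (d : X -> X -> R) (U : X -> Prop) : Prop :=
  forall x, U x -> exists eps, 0 < eps /\ forall y, d x y < eps -> U y.

Definition m_closed {X : Type} (d : X -> X -> R) (U : X -> Prop) : Prop :=
  m_open d (fun x => ~ U x).

Definition m_clopen {X : Type} (d : X -> X -> R) (U : X -> Prop) : Prop :=
  m_open d U /\ m_closed d U.

Definition diam_lt {X : Type} (d : X -> X -> R) (U : X -> Prop) (eps : R) : Prop :=
  exists delta, delta < eps /\ forall x y, U x -> U y -> d x y <= delta.

Definition m_continuous {X : Type} (d : X -> X -> R) (f : X -> X) : Prop :=
  forall x eps, 0 < eps -> exists delta, 0 < delta /\
    forall y, d x y < delta -> d (f x) (f y) < eps.

Definition m_homeo {X : Type} (d : X -> X -> R) (f : X -> X) : Prop :=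
  exists g : X -> X, (forall x, g (f x) = x) /\ (forall x, f (g x) = x) /\
    m_continuous d f /\ m_continuous d g.

(* Cantor space: a metric space homeomorphic to {0,1}^N (product top.)  *)

Definition agree_upto (n : nat) (w w' : nat -> bool) : Prop :=
  forall i, (i < n)%nat -> w i = w' i.

Definition is_metric_cantor (X : Type) (d : X -> X -> R) : Prop :=
  is_metric X d /\
  exists (h : X -> (nat -> bool)) (k : (nat -> bool) -> X),
    (forall x, k (h x) = x) /\ (forall w, h (k w) = w) /\
    (forall x n, exists delta, 0 < delta /\
        forall y, d x y < delta -> agree_upto n (h x) (h y)) /\
    (forall w eps, 0 < eps -> exists n,
        forall w', agree_upto n w w' -> d (k w) (k w') < eps).

Record is_group (G : Type) (mul : G -> G -> G) (inv : G -> G) (one : G) : Prop := {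
  grp_assoc : forall a b c, mul a (mul b c) = mul (mul a b) c;
  grp_mul1g : forall a, mul one a = a;
  grp_mulg1 : forall a, mul a one = a;
  grp_mulVg : forall a, mul (inv a) a = one;
  grp_mulgV : forall a, mul a (inv a) = one
}.

Definition is_countable (G : Type) : Prop :=
  exists f : G -> nat, forall a b, f a = f b -> a = b.

Section GroupDefs.
Context {G : Type} (mul : G -> G -> G) (inv : G -> G) (one : G).

Definition is_subgroup (H : G -> Prop) : Prop :=
  H one /\ (forall a b, H a -> H b -> H (mul a b)) /\ (forall a, H a -> H (inv a)).

Definition gen (P : G -> Prop) (g : G) : Prop :=
  forall K, is_subgroup K -> (forall a, P a -> K a) -> K g.

Definition fin_generated (H : G -> Prop) : Prop :=
  exists s : list G, forall g, H g <-> gen (fun a => In a s) g.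

Definition commg (a b : G) : G := mul (mul (inv a) (inv b)) (mul a b).

Fixpoint lcs (H : G -> Prop) (n : nat) : G -> Prop :=
  match n with
  | O => H
  | S m => gen (fun c => exists a b, lcs H m a /\ H b /\ c = commg a b)
  end.

Definition is_nilpotent_subgroup (H : G -> Prop) : Prop :=
  is_subgroup H /\ exists n, forall g, lcs H n g -> g = one.

Definition has_index (H : G -> Prop) (n : nat) : Prop :=
  exists l : list G, length l = n /\
    (forall i j, (i < n)%nat -> (j < n)%nat -> i <> j ->
        ~ H (mul (inv (nth i l one)) (nth j l one))) /\
    (forall g, exists a, In a l /\ H (mul (inv a) g)).

Definition finite_index (H : G -> Prop) : Prop := exists n, has_index H n.

End GroupDefs.

Definition virtually_fg_nilpotent {G : Type} (mul : G -> G -> G) (inv : G -> G)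
  (one : G) : Prop :=
  exists H : G -> Prop, is_nilpotent_subgroup mul inv one H /\
    fin_generated mul inv one H /\ finite_index mul inv one H.

Definition is_action {G X : Type} (mul : G -> G -> G) (one : G)
  (Phi : G -> X -> X) : Prop :=
  (forall x, Phi one x = x) /\ (forall a b x, Phi (mul a b) x = Phi a (Phi b x)).

Definition minimal_action {G X : Type} (d : X -> X -> R) (Phi : G -> X -> X) : Prop :=
  forall x y eps, 0 < eps -> exists g, d (Phi g x) y < eps.

Definition equicontinuous_action {G X : Type} (d : X -> X -> R)
  (Phi : G -> X -> X) : Prop :=
  forall eps, 0 < eps -> exists delta, 0 < delta /\
    forall g x y, d x y < delta -> d (Phi g x) (Phi g y) < eps.

Definition cantor_action {G X : Type} (d : X -> X -> R) (mul : G -> G -> G)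
  (inv : G -> G) (one : G) (Phi : G -> X -> X) : Prop :=
  is_metric_cantor X d /\ is_group G mul inv one /\ is_countable G /\
  is_action mul one Phi /\ (forall g, m_homeo d (Phi g)) /\
  minimal_action d Phi /\ equicontinuous_action d Phi.

Definition nilpotent_cantor_action {G X : Type} (d : X -> X -> R)
  (mul : G -> G -> G) (inv : G -> G) (one : G) (Phi : G -> X -> X) : Prop :=
  cantor_action d mul inv one Phi /\ virtually_fg_nilpotent mul inv one.

Definition maps_onto_self {G X : Type} (Phi : G -> X -> X) (g : G)
  (U : X -> Prop) : Prop :=
  forall y, (exists x, U x /\ Phi g x = y) <-> U y.

Definition stabilizer {G X : Type} (Phi : G -> X -> X) (U : X -> Prop) : G -> Prop :=
  fun g => maps_onto_self Phi g U.

Definition adapted {G X : Type} (d : X -> X -> R) (Phi : G -> X -> X)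
  (U : X -> Prop) : Prop :=
  m_clopen d U /\ (exists x, U x) /\
  forall g, (exists x, U x /\ U (Phi g x)) -> maps_onto_self Phi g U.

Definition adapted_nbhd_basis {G X : Type} (d : X -> X -> R) (Phi : G -> X -> X)
  (x : X) (U : nat -> X -> Prop) : Prop :=
  (forall l, adapted d Phi (U l)) /\
  (forall l y, U (S l) y -> U l y) /\
  (forall l, exists y, U l y /\ ~ U (S l) y) /\
  (forall y, (forall l, U l y) <-> y = x).

Definition in_prime_spectrum_of {G X : Type} (mul : G -> G -> G) (inv : G -> G)
  (one : G) (Phi : G -> X -> X) (U : nat -> X -> Prop) (p : nat) : Prop :=
  prime (Z.of_nat p) /\
  exists l n, has_index mul inv one (stabilizer Phi (U l)) n /\ Nat.divide p n.

(* The prime spectrum pi[X, Gamma, Phi] is finite (computed from some adapted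
   neighborhood basis at some point; independent of the choices). *)
Definition finite_prime_spectrum {G X : Type} (d : X -> X -> R) (mul : G -> G -> G)
  (inv : G -> G) (one : G) (Phi : G -> X -> X) : Prop :=
  exists (x : X) (U : nat -> X -> Prop),
    adapted_nbhd_basis d Phi x U /\
    exists L : list nat, forall p, in_prime_spectrum_of mul inv one Phi U p -> In p L.

Definition closure_group {G X : Type} (d : X -> X -> R) (Phi : G -> X -> X)
  (h : X -> X) : Prop :=
  m_homeo d h /\
  forall eps, 0 < eps -> exists g, forall x, d (h x) (Phi g x) < eps.

Definition locally_quasi_analytic {X : Type} (d : X -> X -> R)
  (Gs : (X -> X) -> Prop) : Prop :=
  exists eps, 0 < eps /\
    forall U V : X -> Prop,
      m_open d U -> (exists x, U x) -> diam_lt d U eps ->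
      m_open d V -> (exists x, V x) -> (forall x, V x -> U x) ->
      forall g1 g2, Gs g1 -> Gs g2 ->
        (forall x, V x -> g1 x = g2 x) -> forall x, U x -> g1 x = g2 x.

Definition stable_action {G X : Type} (d : X -> X -> R) (Phi : G -> X -> X) : Prop :=
  locally_quasi_analytic d (closure_group d Phi).

(* Main.v *)
(* Fix an adapted basis [U_l] and write [x ~_m y] when [x] and [y] lie in a common translate of [U_m].
   For [Gamma_(l,m) := {g | g y ~_m y for all y in U_l}], the elements of the closure of [Phi(Gamma)] that
   fix [U_l] pointwise form the limit over [m] of [Gamma_(l,m)], and stability means that these limits are
   eventually independent of [l]: for [l >= l0] every [Gamma_(l0,m)] contains some [Gamma_(l,m')].
   This ascending chain condition is checked on the layers of the series
   Gamma > N = N_0 > N_1 > ... > 1, where [N] is nilpotent and the lower central series of [N] has been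
   refined to a series with cyclic factors. On a cyclic layer generated by [a] over [B], the exponents [n]
   such that [a^n B] meets [Gamma_(l,m)] are the multiples of an integer [d_(l,m)], which increases with [m]
   and decreases with [l] for divisibility. If the primes dividing the [d_(l,m)] are bounded, the finitely
   many valuations [sup_m v_p(d_(l,m))] are eventually constant in [l], which gives the condition.
   The bound on primes comes from nilpotency: modulo the kernel of its action on the translates of [U_m],
   [N] is a finite nilpotent group, and a Sylow q-subgroup of it lies in all point stabilizers, hence is
   trivial, as soon as [q] does not divide their indices. *)
Require Import Defs.
From Stdlib Require Import Reals List Arith ZArith Znumtheory.
From Stdlib Require Import Lra Classical ClassicalEpsilon.
From mathcomp Require Import all_boot all_fingroup all_solvable zify.

Close Scope R_scope.
Delimit Scope R_scope with coqR.
Local Open Scope nat_scope.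

(** * Arithmetic: smooth numbers, ideals of exponents, stabilizing suprema *)

Definition smooth (D k : nat) := forall p, prime.prime p -> p %| k -> p <= D.

Lemma smooth_dvdn D e k : e %| k -> smooth D k -> smooth D e.
Proof. by move=> ek sk p pp pe; apply: sk => //; apply: dvdn_trans ek. Qed.

(** All primes of [d] are at most [D], so a number of valuations fixed in advance decides
    divisibility. *)
Lemma smooth_dvdn_logn D d e : 0 < d -> 0 < e -> smooth D d ->
  (forall p, p < D.+1 -> logn p d <= logn p e) -> d %| e.
Proof.
move=> d0 e0 sd le; apply/dvdn_partP=> // p pd.
rewrite p_part pfactor_dvdn //; last by move: pd; rewrite mem_primes; case/andP.
apply: le; move: pd; rewrite mem_primes => /and3P[pp _ pd].
by rewrite ltnS; apply: sd.
Qed.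

(** The generator is the least positive element, reached by descent from [k]; remainders modulo it
    stay in [E]. *)
Lemma nat_ideal_generator (E : nat -> Prop) k : 0 < k -> E k ->
  (forall m n, E m -> E n -> E (m + n)) ->
  (forall m n, m <= n -> E m -> E n -> E (n - m)) ->
  exists d, [/\ 0 < d, E d & forall n, E n -> d %| n].
Proof.
move=> k0 Ek ED EB.
have [d [d0 Ed dmin]] : exists d, [/\ 0 < d, E d & forall n, E n -> n < d -> n = 0].
  elim/ltn_ind: k k0 Ek => k IH k0 Ek.
  case: (classic (exists n, [/\ E n, n < k & 0 < n])) => [[n [En nk n0]]|no].
    exact: IH En.
  exists k; split=> // n En nk; case: (posnP n) => // n0; case: no; by exists n.
have EM q : E (q * d).
  elim: q => [|q IH]; first by rewrite mul0n -(subnn d); apply: EB.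
  by rewrite mulSn; apply: ED.
exists d; split=> // n En; apply/eqP; apply: dmin; last by rewrite ltn_mod.
have -> : n %% d = n - n %/ d * d by rewrite {2}(divn_eq n d) addKn.
by apply: EB => //; apply: leq_divM.
Qed.

(* When [v] increases in [m] and decreases in [l], this says that the decreasing sequence of the suprema
   [sup_m v l m], which may be infinite, is eventually constant. *)
Lemma sup_stabilizes (v : nat -> nat -> nat) :
  exists l0, forall l m, l0 <= l -> exists m', v l0 m <= v l m'.
Proof.
(* If some row is bounded, take one with the least bound: every row reaches that bound. If none is,
   row 0 works, since every row exceeds any given value. *)
case: (classic (exists l b, forall m, v l m <= b)) => [[l1 [b]]|nob].
  elim: b l1 => [|b IH] l1 vb.
    by exists l1 => l m _; exists 0; rewrite (leq_trans (vb m)).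
  case: (classic (exists l, forall m, v l m <= b)) => [[l]|nob]; first exact: IH.
  exists l1 => l m _; apply: NNPP => no; apply: nob; exists l => m'.
  rewrite -ltnS; apply: leq_trans (vb m); rewrite ltnNge; apply/negP => le.
  by apply: no; exists m'.
exists 0 => l m _; apply: NNPP => no; apply: nob; exists l, (v 0 m) => m'.
by case: (leqP (v l m') (v 0 m)) => // /ltnW le; case: no; exists m'.
Qed.

(** Monotonicity merges the thresholds: a larger [l0] only lowers the left side, a larger [m'] only
    raises the right. *)
Lemma sups_stabilize (v : nat -> nat -> nat -> nat) (n : nat) :
  (forall i l l' m, l <= l' -> v i l' m <= v i l m) ->
  (forall i l m m', m <= m' -> v i l m <= v i l m') ->
  exists l0, forall l m, l0 <= l ->
    exists m', forall i, i < n -> v i l0 m <= v i l m'.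
Proof.
move=> vl vm; elim: n => [|n [l1 H1]]; first by exists 0 => l m _; exists 0.
have [l2 H2] := sup_stabilizes (v n).
exists (maxn l1 l2) => l m; rewrite geq_max => /andP[l1l l2l].
have [m1 {}H1] := H1 l m l1l; have [m2 {}H2] := H2 l m l2l.
exists (maxn m1 m2) => i; rewrite ltnS leq_eqVlt => /orP[/eqP->|lt_in].
  apply: (leq_trans (vl _ _ _ _ (leq_maxr l1 l2))); apply: (leq_trans H2).
  exact/vm/leq_maxr.
apply: (leq_trans (vl _ _ _ _ (leq_maxl l1 l2))); apply: (leq_trans (H1 i lt_in)).
exact/vm/leq_maxl.
Qed.

Lemma prime_Zprime p : prime.prime p -> Znumtheory.prime (Z.of_nat p).
Proof.
move=> /primeP[p1 pdiv]; apply/prime_alt; split=> [|n [n1 np] [q eq]]; first by lia.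
have /pdiv : Z.to_nat n %| p by apply/dvdnP; exists (Z.to_nat q); nia.
by rewrite /=; lia.
Qed.

(** * Abstract groups *)

Section AbstractGroup.
Context {G : Type} {mul : G -> G -> G} {inv : G -> G} {one : G}.
Hypothesis grp : is_group G mul inv one.

Local Notation "x ** y" := (mul x y) (at level 40, left associativity).
Local Notation subgroup := (is_subgroup mul inv one).
Local Notation comm := (Defs.commg mul inv).
Local Notation gen := (Defs.gen mul inv one).
Local Notation lcs := (Defs.lcs mul inv one).

Lemma gmulA a b c : a ** b ** c = a ** (b ** c). Proof. by rewrite (grp_assoc _ _ _ _ grp). Qed.
Lemma gmul1 a : one ** a = a. Proof. exact: grp_mul1g grp _. Qed.
Lemma gmulr1 a : a ** one = a. Proof. exact: grp_mulg1 grp _. Qed.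
Lemma gmulV a : inv a ** a = one. Proof. exact: grp_mulVg grp _. Qed.
Lemma gmulrV a : a ** inv a = one. Proof. exact: grp_mulgV grp _. Qed.
Lemma gmulKV a b : inv a ** (a ** b) = b. Proof. by rewrite -gmulA gmulV gmul1. Qed.
Lemma gmulVK a b : a ** (inv a ** b) = b. Proof. by rewrite -gmulA gmulrV gmul1. Qed.
Lemma ginv_unique a b : a ** b = one -> inv a = b.
Proof. by move=> ab; rewrite -(gmulr1 (inv a)) -ab gmulKV. Qed.
Lemma ginvM a b : inv (a ** b) = inv b ** inv a.
Proof. by apply: ginv_unique; rewrite gmulA gmulVK gmulrV. Qed.
Lemma ginvK a : inv (inv a) = a. Proof. exact/ginv_unique/gmulV. Qed.
Lemma ginv_uniquel a b : a ** b = one -> inv b = a.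
Proof. by move=> /ginv_unique <-; rewrite ginvK. Qed.
Lemma ginv1 : inv one = one. Proof. exact/ginv_unique/gmul1. Qed.

(** The ten rules of the Knuth-Bendix completion of the group axioms: they bring words to a normal
    form, which settles free-group identities. *)
Let gsimp := (ginvM, ginvK, ginv1, gmul1, gmulr1, gmulV, gmulrV, gmulKV, gmulVK, gmulA).

Definition gpow (x : G) (n : nat) : G := iter n (mul x) one.

Lemma gpowD x m n : gpow x (m + n) = gpow x m ** gpow x n.
Proof. by elim: m => [|m IH] /=; rewrite ?gsimp // IH. Qed.

Lemma subgroup1 H : subgroup H -> H one. Proof. by case. Qed.
Lemma subgroupM H a b : subgroup H -> H a -> H b -> H (a ** b).
Proof. by case=> _ [h _]; apply: h. Qed.
Lemma subgroupV H a : subgroup H -> H a -> H (inv a).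
Proof. by case=> _ [_ h]; apply: h. Qed.
Lemma subgroupVr H a : subgroup H -> H (inv a) -> H a.
Proof. by move=> sH /(subgroupV _ _ sH); rewrite ginvK. Qed.
Lemma gen_subgroup P : subgroup (gen P).
Proof.
split=> [K sK _|]; first exact: subgroup1 sK.
split=> [a b ga gb K sK PK|a ga K sK PK].
  exact: subgroupM sK (ga K sK PK) (gb K sK PK).
exact: subgroupV sK (ga K sK PK).
Qed.

Lemma gen_in (P : G -> Prop) a : P a -> gen P a.
Proof. by move=> Pa K _; apply. Qed.

Lemma gen_sub (P K : G -> Prop) : subgroup K -> (forall a, P a -> K a) ->
  forall g, gen P g -> K g.
Proof. by move=> sK PK g; apply. Qed.

(** Both conjugations are asked, since one of them may map an infinite [B] properly into itself. *)
Definition normalizes (a : G) (B : G -> Prop) :=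
  forall x, B x -> B (inv a ** x ** a) /\ B (a ** x ** inv a).

Lemma normalizesX a B n : normalizes a B -> normalizes (gpow a n) B.
Proof.
move=> na; elim: n => [|n IH] x Bx /=; first by rewrite !gsimp.
have [/IH[Bl _] _] := na _ Bx; have [_ /na[_ Br]] := IH _ Bx.
by split; [move: Bl | move: Br]; rewrite !gsimp.
Qed.

(** * The chain condition and its layers *)

Section Noetherian.
Variable F : nat -> nat -> G -> Prop.
Hypothesis F_subgroup : forall l m, subgroup (F l m).
Hypothesis F_incr : forall l l' m g, l <= l' -> F l m g -> F l' m g.
Hypothesis F_decr : forall l m m' g, m <= m' -> F l m' g -> F l m g.

(** The intersections over [m] of the [F l m], cut down to [A], grow with [l]; here they stop
    growing at [l0], with one [m'] serving each level [m]. *)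
Definition noetherian_on (A : G -> Prop) :=
  exists l0, forall l m, l0 <= l ->
    exists m', forall g, A g -> F l m' g -> F l0 m g.

Definition noetherian_layer (A B : G -> Prop) :=
  exists l0, forall l m, l0 <= l ->
    exists m', forall g, A g -> F l m' g -> exists h, F l0 m h /\ B (inv h ** g).

(** Modulo [B], [g] agrees with some [h] of the earlier stage; [inv h ** g] falls under the
    condition on [B], and multiplying back by [h] recovers [g]. *)
Lemma noetherian_on_layer A B :
  noetherian_layer A B -> noetherian_on B -> noetherian_on A.
Proof.
move=> [l1 H1] [l2 H2]; exists (maxn l1 l2) => l m; rewrite geq_max => /andP[l1l l2l].
have [m1 {}H2] := H2 l m l2l.
have [m2 {}H1] := H1 l (maxn m m1) l1l.
exists (maxn m1 m2) => g Ag Fg.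
have [h [Fh Bhg]] := H1 g Ag (F_decr _ _ _ _ (leq_maxr _ _) Fg).
have Fhg : F l m1 (inv h ** g).
  apply: subgroupM => //; last exact: F_decr (leq_maxl _ _) Fg.
  apply: subgroupV => //; apply: F_incr l1l _.
  exact: F_decr (leq_maxr _ _) Fh.
have F2 := F_incr _ _ _ _ (leq_maxr l1 l2) (H2 _ Bhg Fhg).
have F1 := F_incr _ _ _ _ (leq_maxl l1 l2) (F_decr _ _ _ _ (leq_maxl _ _) Fh).
by have := subgroupM _ _ _ (F_subgroup _ _) F1 F2; rewrite !gsimp.
Qed.

Lemma noetherian_on_trivial (A : G -> Prop) :
  (forall g, A g -> g = one) -> noetherian_on A.
Proof. by move=> A1; exists 0 => l m _; exists 0 => g /A1-> _; apply: subgroup1. Qed.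

Lemma finite_layer (A B : G -> Prop) (s : list G) : subgroup B ->
  (forall g, A g -> exists a, In a s /\ B (inv a ** g)) ->
  noetherian_layer A B.
Proof.
move=> sB cover.
pose meets i l m := exists x, B x /\ F l m (List.nth i s one ** x).
(* The value 0 marks a coset that meets [F l m], so that [v] decreases in [l] and increases in
   [m]. *)
pose v i l m := if excluded_middle_informative (meets i l m) then 0 else 1.
have meets_incr i l l' m : l <= l' -> meets i l m -> meets i l' m.
  by move=> ll' [x [Bx Fx]]; exists x; split=> //; apply: F_incr ll' _.
have meets_decr i l m m' : m <= m' -> meets i l m' -> meets i l m.
  by move=> mm' [x [Bx Fx]]; exists x; split=> //; apply: F_decr mm' _.
have [i l l' m ll'|i l m m' mm'|l0 H] := sups_stabilize v (length s).
- rewrite /v; case: excluded_middle_informative => // ni.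
  by case: excluded_middle_informative => // y; case: ni; apply: meets_incr ll' y.
- rewrite /v; case: excluded_middle_informative => // ni.
  by case: excluded_middle_informative => // y; case: ni; apply: meets_decr mm' y.
exists l0 => l m l0l; have [m' {}H] := H l m l0l; exists m' => g Ag Fg.
have [a [/(In_nth _ _ one)[i [/ltP lti ai]] Bg]] := cover g Ag.
have lev := H i lti.
case: (classic (meets i l0 m)) => [[x [Bx Fx]]|no].
  exists (List.nth i s one ** x); split=> //; rewrite ai !gsimp.
  by apply: subgroupM => //; apply: subgroupV.
have yes : meets i l m' by exists (inv a ** g); rewrite ai !gsimp.
by move: lev; rewrite /v; do 2 case: excluded_middle_informative.
Qed.

(** Exponents being natural, the covering hypothesis puts [g] or its inverse into a coset [a^n B].
    The smooth powers of [a] make the ideals of exponents nonzero and bound the primes of their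
    generators. *)
Lemma cyclic_layer (A B : G -> Prop) (a : G) (D : nat) :
  subgroup B -> normalizes a B ->
  (forall g, A g -> exists n, B (inv (gpow a n) ** g) \/ B (inv (gpow a n) ** inv g)) ->
  (forall l m, exists k, [/\ 0 < k, smooth D k & F l m (gpow a k)]) ->
  noetherian_layer A B.
Proof.
move=> sB na cover smth.
pose E l m n := exists x, B x /\ F l m (gpow a n ** x).
have gen_E l m : {d | [/\ 0 < d, smooth D d, E l m d & forall n, E l m n -> d %| n]}.
  apply: constructive_indefinite_description.
  have [k [k0 sk Fk]] := smth l m.
  have Ek : E l m k by exists one; split; [apply: subgroup1 | rewrite !gsimp].
  have [n n' [x [Bx Fx]] [y [By Fy]]|n n' nn' [x [Bx Fx]] [y [By Fy]]|d [d0 Ed dvd]] :=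
    nat_ideal_generator _ _ k0 Ek.
  (* Moving [x] to the right past [a^n'] conjugates it; the other witnesses of this kind arise in
     the same way. *)
  - exists (inv (gpow a n') ** x ** gpow a n' ** y); split.
      by apply: subgroupM => //; case: (normalizesX _ _ n' na _ Bx).
    by have := subgroupM _ _ _ (F_subgroup _ _) Fx Fy; rewrite gpowD !gsimp.
  - exists (inv (gpow a (n' - n)) ** inv x ** gpow a (n' - n) ** y); split.
      apply: subgroupM => //; case: (normalizesX _ _ (n' - n) na (inv x)) => //.
      exact: subgroupV.
    have := subgroupM _ _ _ (F_subgroup _ _) (subgroupV _ _ (F_subgroup _ _) Fx) Fy.
    by rewrite -{1}(subnKC nn') gpowD !gsimp.
  by exists d; split=> //; apply: smooth_dvdn sk; apply: dvd.
pose d l m := sval (gen_E l m).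
have d_gt0 l m : 0 < d l m by rewrite /d; case: (gen_E l m) => ? [].
have d_smooth l m : smooth D (d l m) by rewrite /d; case: (gen_E l m) => ? [].
have d_E l m : E l m (d l m) by rewrite /d; case: (gen_E l m) => ? [].
have d_dvd l m n : E l m n -> d l m %| n by rewrite /d; case: (gen_E l m) => /= ? [_ _ _ H]; apply: H.
have E_mul l m n k : E l m n -> E l m (k * n).
  move=> En; elim: k => [|k [y [By Fy]]].
    by exists one; split; [apply: subgroup1|rewrite !gsimp; apply: subgroup1].
  have [x [Bx Fx]] := En.
  exists (inv (gpow a (k * n)) ** x ** gpow a (k * n) ** y); split.
    by apply: subgroupM => //; case: (normalizesX _ _ (k * n) na _ Bx).
  by have := subgroupM _ _ _ (F_subgroup _ _) Fx Fy; rewrite mulSn gpowD !gsimp.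
have [p l l' m ll'|p l m m' mm'|l0 H] := sups_stabilize (fun p l m => logn p (d l m)) D.+1.
- apply: dvdn_leq_log => //; apply: d_dvd; have [x [Bx Fx]] := d_E l m.
  by exists x; split=> //; apply: F_incr ll' _.
- apply: dvdn_leq_log => //; apply: d_dvd; have [x [Bx Fx]] := d_E l m'.
  by exists x; split=> //; apply: F_decr mm' _.
exists l0 => l m l0l; have [m' {}H] := H l m l0l; exists m'.
have dd : d l0 m %| d l m' by apply: smooth_dvdn_logn H.
have lift n x : B x -> F l m' (gpow a n ** x) -> exists y, B y /\ F l0 m (gpow a n ** y).
  move=> Bx Fx; have /d_dvd : E l m' n by exists x.
  by move=> /(dvdn_trans dd)/dvdnP[k ->]; apply: E_mul.
move=> g /cover[n [Bg|Bg]] Fg.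
  have [|y [By Fy]] := lift n _ Bg; first by rewrite !gsimp.
  exists (gpow a n ** y); split=> //; rewrite !gsimp.
  by apply: subgroupM => //; apply: subgroupV.
have [|y [By Fy]] := lift n _ Bg; first by rewrite !gsimp; apply: subgroupV.
(* Here [inv g] lies in [a^n B], so the lifted element is inverted; [inv h ** g] is then a conjugate
   by [a^n] of an element of [B]. *)
exists (inv (gpow a n ** y)); split; first exact: subgroupV.
have : B (y ** inv (inv (gpow a n) ** inv g)).
  by apply: subgroupM => //; apply: subgroupV.
by move=> /(normalizesX _ _ n na)[_]; rewrite !gsimp.
Qed.

End Noetherian.

(** * The lower central series and its finitely generated factors *)

Lemma lcs_subgroup H n : subgroup H -> subgroup (lcs H n).
Proof. by case: n => // n _; apply: gen_subgroup. Qed.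

Lemma lcs_commg H n a b : lcs H n a -> H b -> lcs H n.+1 (comm a b).
Proof. by move=> Ha Hb; apply: gen_in; exists a, b. Qed.

Lemma lcsS_sub H n g : subgroup H -> lcs H n.+1 g -> lcs H n g.
Proof.
move=> sH; elim: n g => [|n IH] g; apply: gen_sub; try exact: lcs_subgroup.
  move=> _ [a [b [Ha [Hb ->]]]].
  by do !apply: subgroupM => //; apply: subgroupV.
by move=> _ [a [b [Ha [Hb ->]]]]; apply: (lcs_commg H) Hb; apply: IH.
Qed.

Lemma lcs_sub H n g : subgroup H -> lcs H n g -> H g.
Proof. by move=> sH; elim: n => // n IH /(lcsS_sub _ _ _ sH)/IH. Qed.

(** The conjugate of [comm x b] by [y] is written [comm x b ** comm (comm x b) y], so that the
    defect of multiplicativity is a commutator one term deeper. *)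
Lemma commMl x y b : comm (x ** y) b = comm x b ** comm (comm x b) y ** comm y b.
Proof. by rewrite /Defs.commg !gsimp. Qed.

Lemma commMr a x y : comm a (x ** y) = comm a y ** comm a x ** comm (comm a x) y.
Proof. by rewrite /Defs.commg !gsimp. Qed.

Lemma comm1r a : comm a one = one.
Proof. by rewrite /Defs.commg !gsimp. Qed.

Lemma comm1l a : comm one a = one.
Proof. by rewrite /Defs.commg !gsimp. Qed.

(* Modulo the next term of the lower central series the commutator is bimultiplicative, so commutators of
   generators generate. *)
Lemma lcs_generated H n (s0 s : list G) : subgroup H ->
  (forall g, H g <-> gen (fun a => In a s0) g) ->
  (forall a, In a s -> lcs H n a) ->
  (forall g, lcs H n g -> gen (fun a => In a s \/ lcs H n.+1 a) g) ->
  exists t : list G, (forall a, In a t -> lcs H n.+1 a) /\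
    (forall g, lcs H n.+1 g -> gen (fun a => In a t \/ lcs H n.+2 a) g).
Proof.
move=> sH gH s_in gs.
exists (List.map (fun u => comm u.1 u.2) (List.list_prod s s0)); split.
  move=> _ /in_map_iff[[a b] [<- /in_prod_iff[sa sb]]].
  by apply: (lcs_commg H); [apply: s_in | apply/gH; apply: gen_in].
set t := List.map _ _.
set T := gen (fun a => In a t \/ lcs H n.+2 a).
have sT : subgroup T by apply: gen_subgroup.
have T2 g : lcs H n.+2 g -> T g by move=> ?; apply: gen_in; right.
have Tt g : In g t -> T g by move=> ?; apply: gen_in; left.
clearbody T.
have sH1 := lcs_subgroup H n.+1 sH.
(* First the left entry is a listed generator and the right one varies over [H]; then the left entry
   varies as well. *)
have step1 a : In a s -> forall b, H b -> T (comm a b).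
  move=> sa b Hb; have la := s_in a sa.
  suff [] : H b /\ T (comm a b) by [].
  move/gH: Hb; apply: (gen_sub _ (fun b => H b /\ T (comm a b))) => [|c sc].
  - split; first by rewrite comm1r; split; [apply: (subgroup1 H) | apply: (subgroup1 T)].
    split=> [x y [Hx Tx] [Hy Ty]|x [Hx Tx]].
      split; first exact: subgroupM.
      rewrite commMr; apply: subgroupM => //; first exact: subgroupM.
      by apply: T2; apply: (lcs_commg H) => //; apply: (lcs_commg H).
    have Hx' := subgroupV _ _ sH Hx; split=> //.
    (* Expanding [comm a (x ** inv x)], which is [one], expresses [comm a (inv x)] through elements
       of [T]. *)
    have : T (inv (comm a x ** comm (comm a x) (inv x))).
      apply: subgroupV => //; apply: subgroupM => //.
      by apply: T2; apply: (lcs_commg H) => //; apply: (lcs_commg H).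
    suff -> : inv (comm a x ** comm (comm a x) (inv x)) = comm a (inv x) by [].
    by apply: ginv_uniquel; rewrite -gmulA -commMr gmulrV comm1r.
  split; first by apply/gH; apply: gen_in.
  apply/Tt/in_map_iff; exists (a, c); split=> //.
  by apply/in_prod_iff.
have step2 a : lcs H n a -> forall b, H b -> T (comm a b).
  move=> /gs ga; suff [] : lcs H n a /\ forall b, H b -> T (comm a b) by [].
  apply: (gen_sub _ (fun a => lcs H n a /\ forall b, H b -> T (comm a b)) _ _ a ga).
    split.
      split; first exact: (subgroup1 _ (lcs_subgroup H n sH)).
      by move=> b _; rewrite comm1l; apply: (subgroup1 T).
    split=> [x y [lx Tx] [ly Ty]|x [lx Tx]].
      split; first exact: (subgroupM _ _ _ (lcs_subgroup H n sH)).
      move=> b Hb; rewrite commMl; apply: subgroupM => //; last exact: Ty.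
      apply: subgroupM => //; first exact: Tx.
      apply: T2; apply: (lcs_commg H); first exact: (lcs_commg H).
      exact: (lcs_sub H n).
    have lx' := subgroupV _ _ (lcs_subgroup H n sH) lx; split=> // b Hb.
    have : T (inv (comm x b ** comm (comm x b) (inv x))).
      apply: subgroupV => //; apply: subgroupM => //; first exact: Tx.
      apply: T2; apply: (lcs_commg H); first exact: (lcs_commg H).
      exact: (lcs_sub H n).
    suff -> : inv (comm x b ** comm (comm x b) (inv x)) = comm (inv x) b by [].
    by apply: ginv_unique; rewrite -commMl gmulrV comm1l.
  move=> c [/[dup]/s_in lc sc|lc]; first by split=> //; apply: step1.
  split; first exact: lcsS_sub.
  by move=> b Hb; apply: T2; apply: (lcs_commg H).
by apply: gen_sub => // _ [a [b [la [Hb ->]]]]; apply: step2.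
Qed.

Lemma lcs_fin_generated H n : subgroup H -> fin_generated mul inv one H ->
  exists s : list G, (forall a, In a s -> lcs H n a) /\
    (forall g, lcs H n g -> gen (fun a => In a s \/ lcs H n.+1 a) g).
Proof.
move=> sH [s0 gH]; elim: n => [|n [s [s_in gs]]]; last exact: lcs_generated gs.
exists s0; split=> [a sa|g /gH]; first by apply/gH; apply: gen_in.
by apply: gen_sub => [|a sa]; [apply: gen_subgroup | apply: gen_in; left].
Qed.

(** * The chain condition for finitely generated nilpotent groups *)

Section NoetherianNilpotent.
Variable F : nat -> nat -> G -> Prop.
Hypothesis F_subgroup : forall l m, subgroup (F l m).
Hypothesis F_incr : forall l l' m g, l <= l' -> F l m g -> F l' m g.
Hypothesis F_decr : forall l m m' g, m <= m' -> F l m' g -> F l m g.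
Variables (H : G -> Prop) (D : nat).
Hypothesis sH : subgroup H.
Hypothesis F_smooth : forall l m a, H a ->
  exists k, [/\ 0 < k, smooth D k & F l m (gpow a k)].

(** Generators of the factor are added one at a time. Each new [a] normalizes the subgroup [B] built
    so far, since commutators of [B] with [a] fall into the next term, so every step is a cyclic
    layer. *)
Lemma noetherian_on_lcs n : fin_generated mul inv one H ->
  noetherian_on F (lcs H n.+1) -> noetherian_on F (lcs H n).
Proof.
move=> fgH noeS; have [s [s_in gs]] := lcs_fin_generated H n sH fgH.
suff : noetherian_on F (gen (fun a => In a s \/ lcs H n.+1 a)).
  move=> [l0 noe]; exists l0 => l m l0l; have [m' {}noe] := noe l m l0l.
  by exists m' => g /gs; apply: noe.
have sub_n t : (forall a, In a t -> lcs H n a) ->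
    forall g, gen (fun a => In a t \/ lcs H n.+1 a) g -> lcs H n g.
  move=> t_in; apply: gen_sub; first exact: lcs_subgroup.
  by move=> a [/t_in//|]; apply: lcsS_sub.
elim: s s_in {gs} => [|a s IH] s_in.
  case: noeS => l0 noe; exists l0 => l m l0l; have [m' {}noe] := noe l m l0l.
  exists m' => g gg.
  apply: noe; by apply: gen_sub gg => [|b [[]|]] //; apply: lcs_subgroup.
have {}IH : noetherian_on F (gen (fun a => In a s \/ lcs H n.+1 a)).
  by apply: IH => b sb; apply: s_in; right.
have {}sub_n := sub_n s (fun b sb => s_in b (or_intror sb)).
set B := gen _ in IH sub_n.
have sB : subgroup B by apply: gen_subgroup.
have sub1 g : lcs H n.+1 g -> B g by move=> ?; apply: gen_in; right.
have subs g : In g s -> B g by move=> ?; apply: gen_in; left.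
clearbody B.
have la : lcs H n a by apply: s_in; left.
have Ha : H a := lcs_sub _ _ _ sH la.
have na : normalizes a B.
  move=> x Bx; have lx := sub_n x Bx.
  split.
    have -> : inv a ** x ** a = x ** comm x a by rewrite /Defs.commg !gsimp.
    by apply: subgroupM => //; apply: sub1; apply: (lcs_commg H).
  have -> : a ** x ** inv a = x ** comm x (inv a) by rewrite /Defs.commg !gsimp.
  by apply: subgroupM => //; apply: sub1; apply: (lcs_commg H) => //; apply: subgroupV.
apply: (noetherian_on_layer _ F_subgroup F_incr F_decr _ B) => //.
apply: (cyclic_layer _ F_subgroup F_incr F_decr _ _ a D) => // [g gg|l m].
  (* [K] is the union of the cosets [a^(i-k) B], an integer exponent being a difference of
     naturals. *)
  pose K g := exists i k x, B x /\ gpow a k ** g = gpow a i ** x.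
  have [i [k [x [Bx kg]]]] : K g; last first.
    have eg : g = inv (gpow a k) ** gpow a i ** x by rewrite gmulA -kg !gsimp.
    case: (leqP k i) => [kn|/ltnW nk].
      exists (i - k); left; rewrite eg.
      have -> : gpow a i = gpow a k ** gpow a (i - k) by rewrite -gpowD subnKC.
      by rewrite !gsimp.
    exists (k - i); right; rewrite eg.
    have -> : gpow a k = gpow a i ** gpow a (k - i) by rewrite -gpowD subnKC.
    rewrite !gsimp -gmulA.
    by case: (normalizesX _ _ (k - i) na (inv x)) => //; apply: subgroupV.
  apply: gen_sub gg => [|b [[<-|sb]|lb]].
  - split; first by exists 0, 0, one; split; [apply: subgroup1 | rewrite !gsimp].
    split=> [g1 g2 [i [k [x [Bx e1]]]] [i' [k' [x' [Bx' e2]]]]|g1 [i [k [x [Bx e1]]]]].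
      exists (i + i'), (k' + k).
      exists (inv (gpow a i') ** (gpow a k' ** x ** inv (gpow a k')) ** gpow a i' ** x').
      split.
        apply: subgroupM => //.
        exact: (proj1 (normalizesX _ _ i' na _ (proj2 (normalizesX _ _ k' na x Bx)))).
      rewrite gpowD gmulA -(gmulA _ g1) e1 -!gmulA -gpowD addnC.
      by rewrite !gpowD !gmulA gmulVK -e2 !gsimp.
    exists k, i, (inv (gpow a k) ** (gpow a i ** inv x ** inv (gpow a i)) ** gpow a k).
    split.
      have Bx' := proj2 (normalizesX _ _ i na _ (subgroupV _ _ sB Bx)).
      exact: (proj1 (normalizesX _ _ k na _ Bx')).
    have -> : g1 = inv (gpow a k) ** (gpow a i ** x) by rewrite -e1 !gsimp.
    by rewrite !gsimp.
  - by exists 1, 0, one; split; [apply: subgroup1 | rewrite /= !gsimp].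
  - by exists 0, 0, b; split=> //; apply: subs.
  by exists 0, 0, b; split=> //; apply: sub1.
exact: F_smooth.
Qed.

Lemma noetherian_on_nilpotent n : fin_generated mul inv one H ->
  (forall g, lcs H n g -> g = one) -> noetherian_on F H.
Proof.
move=> fgH lcs1; have := noetherian_on_trivial _ F_subgroup _ lcs1.
by elim: n {lcs1} => // n IH /noetherian_on_lcs-/(_ fgH)/IH.
Qed.

End NoetherianNilpotent.
(** [G] permutes the left cosets of [H] by translation; [i0] is the coset [H] itself, whose chosen
    representative may differ from [one]. *)
Lemma coset_action H n : subgroup H -> has_index mul inv one H n ->
  exists (psi : G -> {perm 'I_n}) (i0 : 'I_n),
    [/\ forall a b, psi (a ** b) = (psi a * psi b)%g,
        forall g, psi g i0 = i0 <-> H g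
      & forall i, exists g, psi g i0 = i].
Proof.
move=> sH [l [sl [l_inj l_cover]]].
pose r (i : 'I_n) := List.nth i l one.
have r_inj i j : H (inv (r i) ** r j) -> i = j.
  move=> Hij; apply/eqP; apply: contraT => /eqP ij; case: (l_inj i j) => //.
  - by apply/ltP.
  - by apply/ltP.
  - by move/val_inj.
have idx_ex g : {i : 'I_n | H (inv (r i) ** g)}.
  apply: constructive_indefinite_description.
  have [a [/(In_nth _ _ one)[i [/ltP lti ai]] Ha]] := l_cover g.
  have lti' : i < n by rewrite -sl.
  by exists (Ordinal lti'); rewrite /r /= ai.
pose idx g := sval (idx_ex g).
have idxP g : H (inv (r (idx g)) ** g) by rewrite /idx; case: (idx_ex g).
have idx_eq i g : H (inv (r i) ** g) -> idx g = i.
  move=> Hi; apply: r_inj.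
  by have := subgroupM _ _ _ sH (idxP g) (subgroupV _ _ sH Hi); rewrite !gsimp.
(* MathComp permutations compose from left to right, whence the inverse. *)
pose act g i := idx (inv g ** r i).
have act_inj g : injective (act g).
  move=> i j eij; have Hi := idxP (inv g ** r i); have Hj := idxP (inv g ** r j).
  move: Hi; rewrite -/(act g i) eij => Hi; apply: r_inj.
  by have := subgroupM _ _ _ sH (subgroupV _ _ sH Hi) Hj; rewrite !gsimp.
have r0 : H (r (idx one)).
  by have := subgroupV _ _ sH (idxP one); rewrite !gsimp.
exists (fun g => perm (act_inj g)), (idx one); split.
- move=> a b; apply/permP => i; rewrite permM !permE; apply: idx_eq.
  have := subgroupM _ _ _ sH (idxP (inv b ** r (act a i))) (idxP (inv a ** r i)).
  by rewrite !gsimp.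
- move=> g; rewrite permE; split=> [e|Hg].
    have := idxP (inv g ** r (idx one)); rewrite -/(act g _) e => Hg.
    have := subgroupM _ _ _ sH r0 (subgroupM _ _ _ sH Hg (subgroupV _ _ sH r0)).
    by rewrite !gsimp => /subgroupVr; apply.
  apply: idx_eq; apply: subgroupM => //; first exact: subgroupV.
  by apply: subgroupM => //; apply: subgroupV.
move=> i; exists (r (idx one) ** inv (r i)); rewrite permE; apply: idx_eq.
by rewrite !gsimp; apply: subgroup1.
Qed.

(** * Finite nilpotent images *)

Section FiniteImage.
Variables (gT : finGroupType) (psi : G -> gT).
Hypothesis psiM : forall a b, psi (a ** b) = (psi a * psi b)%g.

Lemma psi_one : psi one = 1%g.
Proof. by apply: (mulgI (psi one)); rewrite mulg1 -psiM gmul1. Qed.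

Lemma psi_inv a : psi (inv a) = (psi a)^-1%g.
Proof. by apply: (mulgI (psi a)); rewrite mulgV -psiM gmulrV // psi_one. Qed.

Lemma psi_gpow a n : psi (gpow a n) = (psi a ^+ n)%g.
Proof. by elim: n => [|n IH] /=; rewrite ?psi_one ?psiM // IH expgS. Qed.

Definition image_set (N : G -> Prop) : {set gT} :=
  [set s | excluded_middle_informative (exists2 x, N x & s = psi x)].

Lemma image_setP N s : reflect (exists2 x, N x & s = psi x) (s \in image_set N).
Proof. by rewrite inE; apply: sumboolP. Qed.

Lemma image_group_set N : subgroup N -> group_set (image_set N).
Proof.
move=> sN; apply/group_setP; split=> [|_ _ /image_setP[x Nx ->] /image_setP[y Ny ->]].
  by apply/image_setP; exists one; [apply: subgroup1 | rewrite psi_one].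
by apply/image_setP; exists (x ** y); [apply: subgroupM | rewrite psiM].
Qed.

Definition image_group N (sN : subgroup N) : {group gT} := Group (image_group_set N sN).

Lemma image_nilpotent N c (sN : subgroup N) : (forall g, lcs N c g -> g = one) ->
  nilpotent (image_group N sN).
Proof.
move=> lcs1; apply/lcnP; exists c; apply/trivgP.
(* The series ['L_k] starts at index 1 and [lcs] at 0, whence the shift. *)
suff sub k : 'L_k.+1(image_group N sN)%g \subset image_set (lcs N k).
  apply: subset_trans (sub c) _; apply/subsetP => _ /image_setP[x /lcs1-> ->].
  by rewrite psi_one set11.
elim: k => [|k IH]; first by rewrite lcn1.
rewrite lcnSn; have -> : image_set (lcs N k.+1) = image_group _ (lcs_subgroup N k.+1 sN) by [].
rewrite gen_subG; apply/subsetP => _ /imset2P[x y xL /image_setP[b Nb ->] ->].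
have /image_setP[a la ->] := subsetP IH _ xL; apply/image_setP; exists (comm a b).
  exact: lcs_commg.
by rewrite /Defs.commg !psiM !psi_inv commgEl conjgE !mulgA.
Qed.

Lemma image_index_leq N M r (sN : subgroup N) (sM : subgroup M) :
  (forall g, N g -> M g) ->
  has_index mul inv one N r -> #|image_group M sM : image_group N sN|%g <= r.
Proof.
move=> NM [l [sl [_ cover]]]; rewrite -card_lcosets.
pose f (i : 'I_r) := (psi (List.nth i l one) *: image_group N sN)%g.
apply: (leq_trans (n := #|f @: setT|)); last first.
  by apply: leq_trans (leq_imset_card _ _) _; rewrite cardsT card_ord.
apply/subset_leq_card/subsetP => _ /imsetP[_ /image_setP[g _ ->] ->].
have [a [/(In_nth _ _ one)[i [/ltP lti ai]] Na]] := cover g.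
have lti' : i < r by rewrite -sl.
apply/imsetP; exists (Ordinal lti') => //; rewrite /f /= ai lcosetE.
apply/(@lcoset_eqP _ (image_group N sN)); rewrite mem_lcoset -psi_inv -psiM.
by apply/image_setP; exists (inv a ** g).
Qed.

End FiniteImage.

(** By nilpotency ['O_q(A)] is the only Sylow q-subgroup, so each point stabilizer of index prime to
    [q] contains it; a permutation fixing every point is trivial. *)
Lemma nilpotent_perm_order_smooth n D (A : {group {perm 'I_n}}) :
  nilpotent A ->
  (forall (i : 'I_n) q, prime.prime q -> D < q -> ~~ (q %| #|A : 'C_A[i | 'P]|%g)) ->
  smooth D #|A|.
Proof.
move=> nilA stab q pq qA; rewrite leqNgt; apply/negP => Dq.
pose P := 'O_q(A)%G; have hP : q.-Hall(A)%g P := nilpotent_pcore_Hall q nilA.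
have PC i : P \subset ('C_A[i | 'P])%g.
  have [Q sQ] := Sylow_exists q ('C_A[i | 'P])%G.
  have QA : Q \subset A by apply: subset_trans (pHall_sub sQ) (subsetIl _ _).
  suff eQ : Q :=: P by rewrite -eQ; apply: pHall_sub sQ.
  apply/eqP; rewrite eqEcard (sub_normal_Hall hP (pcore_normal _ _) QA) (pHall_pgroup sQ).
  rewrite (card_Hall sQ) (card_Hall hP) -(Lagrange (subsetIl A 'C[i | 'P]%g)).
  rewrite partnM ?cardG_gt0 // (@part_p'nat _ #|A : _|%g) ?muln1 //.
    by rewrite leqnn.
  by rewrite p'natE // stab.
have P1 : P :=: 1%g.
  apply/trivgP/subsetP => s sP; rewrite inE; apply/eqP/permP => i; rewrite perm1.
  by have := subsetP (PC i) s sP; rewrite inE => /andP[_ /astab1P].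
have := card_Hall hP; rewrite P1 cards1 => /esym/eqP; rewrite p_part_eq1.
by rewrite mem_primes pq cardG_gt0 qA.
Qed.

(** Take for [k] the order of the image [A] of [N] in the permutations of the cosets of [H]: the
    power [x^k] acts trivially, hence lies in every conjugate of [H]. *)
Lemma smooth_exponent (N H : G -> Prop) r n c D :
  subgroup N -> subgroup H -> (forall g, lcs N c g -> g = one) ->
  has_index mul inv one N r -> has_index mul inv one H n -> r <= D -> smooth D n ->
  exists k, [/\ 0 < k, smooth D k &
    forall x g, N x -> H (inv g ** gpow x k ** g)].
Proof.
move=> sN sH lcs1 indN indH rD sn.
have [psi [i0 [psiM stab trans]]] := coset_action H n sH indH.
have sT : subgroup (fun _ => True) by [].
pose A := image_group _ psi psiM N sN; pose T := image_group _ psi psiM _ sT.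
have nilA : nilpotent A by apply: image_nilpotent lcs1.
have AT : A \subset T.
  by apply/subsetP => _ /image_setP[x _ ->]; apply/image_setP; exists x.
have psiT g : psi g \in T by apply/image_setP; exists g.
exists #|A|; rewrite cardG_gt0; split=> //; last first.
  move=> x g Nx; apply/stab; rewrite !psiM psi_gpow //.
  have -> : (psi x ^+ #|A| = 1)%g.
    by apply/eqP; rewrite -order_dvdn order_dvdG //; apply/image_setP; exists x.
  by rewrite mulg1 -psiM gmulV // psi_one // perm1.
apply: nilpotent_perm_order_smooth => // i q pq Dq; apply/negP => qi.
(* Transitivity is known only for the image [T] of [G]. To pass to [A], compare the two chains from
   [T] to [S :&: A]: a prime [q > D] dividing the index in [A] must divide [n] or [#|S : S :&: A|],
   and the latter is at most [r]. *)
have orbT : #|T : 'C_T[i | 'P]|%g = n.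
  rewrite -card_orbit -[RHS]card_ord; apply: eq_card => j; rewrite [RHS]inE.
  have [[g gi] [h hj]] := (trans i, trans j); apply/orbitP.
  exists (psi (inv g ** h)) => //=.
  by rewrite /aperm psiM permM psi_inv // -gi permK.
have q_n : ~~ (q %| n) by apply/negP => /(sn q pq); rewrite leqNgt Dq.
have le_r : #|T : A|%g <= r by apply: image_index_leq.
set S := ('C_T[i | 'P])%G in orbT.
have SA : S :&: A = 'C_A[i | 'P]%g by rewrite /= setIAC (setIidPr AT).
have : #|S : S :&: A|%g <= r.
  apply: leq_trans le_r; rewrite -(leq_pmul2l (cardG_gt0 (S :&: A))).
  rewrite Lagrange ?subsetIl // -(leq_pmul2r (cardG_gt0 A)) mul_cardG.
  rewrite mulnC -mulnA leq_pmul2l ?cardG_gt0 // mulnC Lagrange //.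
  by apply: subset_leq_card; rewrite mul_subG // subsetIl.
have : q %| #|T : S|%g * #|S : S :&: A|%g.
  rewrite Lagrange_index ?subsetIl // -(Lagrange_index AT) ?subsetIr //.
  by rewrite /= SA dvdn_mull.
rewrite orbT Euclid_dvdM // (negbTE q_n) => /dvdn_leq-/(_ (indexg_gt0 _ _)) le1 le2.
by move: (leq_trans le1 (leq_trans le2 rD)); rewrite leqNgt Dq.
Qed.

(** The list is thinned to a transversal by dropping elements whose coset already occurs. *)
Lemma finite_index_cover (H : G -> Prop) (s : list G) : is_subgroup mul inv one H ->
  (forall g, exists a, In a s /\ H (inv a ** g)) -> finite_index mul inv one H.
Proof.
move=> sH cover.
have [t [t_inj ts]] : exists t : list G,
    (forall i j, (i < length t)%coq_nat -> (j < length t)%coq_nat -> i <> j ->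
       ~ H (inv (List.nth i t one) ** List.nth j t one)) /\
    (forall a, In a s -> exists b, In b t /\ H (inv b ** a)).
  elim: s {cover} => [|a s [t [t_inj ts]]]; first by exists nil; split=> // i j /ltP.
  case: (classic (exists b, In b t /\ H (inv b ** a))) => [ab|nab].
    by exists t; split=> // c [<-//|]; apply: ts.
  exists (a :: t); split=> [|c [<-|/ts[b [tb Hb]]]].
  - case=> [|i] [|j] //= /ltP lti /ltP ltj ij Hij.
    + apply: nab; exists (List.nth j t one); split; first by apply: nth_In; apply/ltP.
      by have := subgroupV _ _ sH Hij; rewrite !gsimp.
    + by apply: nab; exists (List.nth i t one); split=> //; apply: nth_In; apply/ltP.
    + by case: (t_inj i j) => //; [apply/ltP | apply/ltP | move=> e; apply: ij; rewrite e].
  - by exists a; split; [left | rewrite !gsimp; apply: subgroup1 sH].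
  by exists b; split=> //; right.
exists (length t), t; split=> //; split=> // g.
have [a [/ts[b [tb Hb]] Ha]] := cover g; exists b; split=> //.
by have := subgroupM _ _ _ sH Hb Ha; rewrite !gsimp.
Qed.

End AbstractGroup.

(** * Cantor actions *)

(** Compactness as an induction principle: were the whole space bad, halving cylinders would give a
    nested sequence of bad ones, yet a good ball around the limit point contains one of them. *)
Lemma cantor_compactness (X : Type) (d : X -> X -> R) (P : (X -> Prop) -> Prop) :
  is_metric_cantor X d ->
  (forall A B : X -> Prop, (forall x, A x -> B x) -> P B -> P A) ->
  (forall A B : X -> Prop, P A -> P B -> P (fun x => A x \/ B x)) ->
  (forall x, exists eps, (0 < eps)%coqR /\ P (fun y => (d x y < eps)%coqR)) ->
  P (fun _ => True).
Proof.
move=> [_ [h [k [kh [hk [_ kcont]]]]]] Psub PU Ploc; apply: NNPP => nP.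
pose cyl (s : seq bool) (x : X) := forall i, i < size s -> h x i = nth false s i.
(* Choose the half [true] if it is bad, else [false]; both halves cannot be good when [cyl s] is
   bad. *)
pose next (s : seq bool) := if excluded_middle_informative (P (cyl (rcons s true))) then false else true.
pose pre n := iter n (fun s => rcons s (next s)) [::].
have bad n : ~ P (cyl (pre n)).
  elim: n => [Pn|n IH Pn]; first by apply: nP; apply: Psub Pn => x _ i.
  move: Pn; rewrite /= -/(pre n) {1}/next; case: excluded_middle_informative => // Pt Pf.
  apply: IH; apply: Psub (PU _ _ Pt Pf) => x cx.
  have [hx|hx] : h x (size (pre n)) = true \/ h x (size (pre n)) = false by case: (h x _); auto.
    left => i; rewrite size_rcons ltnS leq_eqVlt nth_rcons => /orP[/eqP->|lti].
      by rewrite ltnn eqxx.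
    by rewrite lti cx.
  right => i; rewrite size_rcons ltnS leq_eqVlt nth_rcons => /orP[/eqP->|lti].
    by rewrite ltnn eqxx.
  by rewrite lti cx.
pose w n := next (pre n).
have size_pre n : size (pre n) = n by elim: n => // n IH; rewrite /= size_rcons IH.
have nth_pre n i : i < n -> nth false (pre n) i = w i.
  elim: n => // n IH; rewrite ltnS leq_eqVlt /= nth_rcons size_pre => /orP[/eqP->|lti].
    by rewrite ltnn eqxx.
  by rewrite lti IH.
have [eps [eps0 Peps]] := Ploc (k w); have [n kn] := kcont w eps eps0.
apply: (bad n); apply: Psub Peps => x cx; rewrite -(kh x); apply: kn => i /ltP lti.
by rewrite cx ?size_pre // nth_pre.
Qed.

Section CantorAction.
Context {X : Type} {d : X -> X -> R} {G : Type}.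
Context {mul : G -> G -> G} {inv : G -> G} {one : G} {Phi : G -> X -> X}.
Hypothesis act : cantor_action d mul inv one Phi.

Local Notation "x ** y" := (mul x y) (at level 40, left associativity).
Let grp : is_group G mul inv one. Proof. by case: act => _ []. Qed.
Let cantor : is_metric_cantor X d. Proof. by case: act. Qed.
Let minimal : minimal_action d Phi. Proof. by case: act => _ [_ [_ [_ [_ []]]]]. Qed.
Let equicont : equicontinuous_action d Phi. Proof. by case: act => _ [_ [_ [_ [_ []]]]]. Qed.
Let gsimp := (ginvM grp, ginvK grp, ginv1 grp, gmul1 grp, gmulr1 grp, gmulV grp,
  gmulrV grp, gmulKV grp, gmulVK grp, gmulA grp).

Lemma act1 x : Phi one x = x. Proof. by case: act => _ [_ [_ [[]]]]. Qed.
Lemma actM a b x : Phi (a ** b) x = Phi a (Phi b x).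
Proof. by case: act => _ [_ [_ [[]]]]. Qed.
Lemma actK a x : Phi (inv a) (Phi a x) = x.
Proof. by rewrite -actM (gmulV grp) act1. Qed.
Lemma actVK a x : Phi a (Phi (inv a) x) = x.
Proof. by rewrite -actM (gmulrV grp) act1. Qed.
Lemma dist_sym x y : d x y = d y x. Proof. by case: cantor => -[]. Qed.
Lemma dist_triangle x y z : (d x z <= d x y + d y z)%coqR. Proof. by case: cantor => -[]. Qed.

Lemma dist_small_eq x y : (forall eps, (0 < eps)%coqR -> (d x y < eps)%coqR) -> x = y.
Proof.
move=> small; case: cantor => -[dpos d0 _ _] _; apply/d0.
have := dpos x y; case: (Rlt_le_dec 0 (d x y)) => [/small|]; lra.
Qed.

Lemma stabilizerP U g : stabilizer Phi U g <-> forall x, U x <-> U (Phi g x).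
Proof.
split=> [st x|st y].
  split=> [Ux|/st[x' [Ux' e]]]; first by apply/st; exists x.
  by rewrite -(actK g x) -e actK.
split=> [[x [Ux <-]]|Uy]; first exact: (proj1 (st x)).
by exists (Phi (inv g) y); rewrite actVK; split=> //; apply: (proj2 (st _)); rewrite actVK.
Qed.

Lemma stabilizer_subgroup U : is_subgroup mul inv one (stabilizer Phi U).
Proof.
split; first by apply/stabilizerP => x; rewrite act1.
split=> [a b /stabilizerP sa /stabilizerP sb|a /stabilizerP sa]; apply/stabilizerP => x.
  by rewrite actM -sa -sb.
by rewrite (sa (Phi (inv a) x)) actVK.
Qed.

(** * The partition into translates of an adapted set *)

Section Adapted.
Variable U : X -> Prop.
Hypothesis adU : adapted d Phi U.

Lemma adapted_stab g x : U x -> U (Phi g x) -> forall y, U y <-> U (Phi g y).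
Proof. by move=> Ux Ugx; apply/stabilizerP; case: adU => _ [_]; apply; exists x. Qed.

Definition same_translate (x y : X) := exists g, U (Phi g x) /\ U (Phi g y).

Lemma adapted_reach x : exists g, U (Phi g x).
Proof.
have [[opU _] [[u Uu] _]] := adU; have [eps [eps0 ball]] := opU u Uu.
by have [g dg] := minimal x u eps eps0; exists g; apply: ball; rewrite dist_sym.
Qed.

Lemma same_translate_refl x : same_translate x x.
Proof. by have [g Ug] := adapted_reach x; exists g. Qed.

Lemma same_translate_sym x y : same_translate x y -> same_translate y x.
Proof. by case=> g [gx gy]; exists g. Qed.

(** The element [g ** inv h] sends a point of [U] into [U], so it stabilizes [U]: translates that
    meet coincide. *)
Lemma same_translate_in g x y : same_translate x y -> U (Phi g x) -> U (Phi g y).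
Proof.
move=> [h [hx hy]] gx.
have := adapted_stab (g ** inv h) (Phi h x) hx.
by rewrite actM actK => /(_ gx)/(_ (Phi h y))[/(_ hy)]; rewrite actM actK.
Qed.

Lemma same_translate_trans x y z :
  same_translate x y -> same_translate y z -> same_translate x z.
Proof. by move=> [g [gx gy]] yz; exists g; split=> //; apply: same_translate_in gy. Qed.

Lemma same_translate_act g x y :
  same_translate x y -> same_translate (Phi g x) (Phi g y).
Proof. by move=> [h [hx hy]]; exists (h ** inv g); rewrite !actM !actK. Qed.

(** Minimality brings [x] close to an interior point [u] of [U], and equicontinuity keeps [y] close
    whichever [g] did so; hence one [delta] for all points. *)
Lemma near_same_translate :
  exists delta, (0 < delta)%coqR /\ forall x y, (d x y < delta)%coqR -> same_translate x y.
Proof.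
have [[opU _] [[u Uu] _]] := adU; have [eps [eps0 ball]] := opU u Uu.
have [|delta [delta0 eq]] := equicont (eps / 2)%coqR; first by lra.
exists delta; split=> // x y /eq dxy; have [|g dg] := minimal x u (eps / 2)%coqR; first by lra.
have := dist_triangle u (Phi g x) (Phi g y); have := dxy g; rewrite dist_sym in dg.
by exists g; split; apply: ball; lra.
Qed.

(** Finitely many translates cover [X]; the one containing [Phi g u] determines the coset of [g]. *)
Lemma stabilizer_finite_index : finite_index mul inv one (stabilizer Phi U).
Proof.
have [s cover] : exists s : list G, forall x, True -> exists a, In a s /\ U (Phi (inv a) x).
  apply: (cantor_compactness _ _ (fun A => exists s : list G, forall x, A x ->
    exists a, In a s /\ U (Phi (inv a) x)) cantor).
  - by move=> A B AB [s Bs]; exists s => x /AB/Bs.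
  - move=> A B [s As] [t Bt]; exists (s ++ t) => x [/As|/Bt] [a [sa Ua]];
    by exists a; split=> //; apply/in_or_app; auto.
  move=> x; have [delta [delta0 near]] := near_same_translate.
  have [g Ug] := adapted_reach x; exists delta; split=> //; exists [:: inv g] => y /near xy.
  exists (inv g); split; first by left.
  by rewrite (ginvK grp); apply: same_translate_in Ug.
apply: (finite_index_cover grp _ s (stabilizer_subgroup U)) => g.
have [_ [[u Uu] _]] := adU; have [a [sa Ua]] := cover (Phi g u) I.
exists a; split=> //; apply/stabilizerP; apply: (adapted_stab _ u) => //.
by rewrite actM.
Qed.

End Adapted.

Lemma same_translate_sub (U V : X -> Prop) x y : (forall z, U z -> V z) ->
  same_translate U x y -> same_translate V x y.
Proof. by move=> UV [g [gx gy]]; exists g; split; apply: UV. Qed.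

(** * Germ groups along an adapted basis, and stability *)

Section Basis.
Variables (x0 : X) (U : nat -> X -> Prop).
Hypothesis basisU : adapted_nbhd_basis d Phi x0 U.

Lemma basis_adapted l : adapted d Phi (U l). Proof. by case: basisU. Qed.

Lemma basis_decr l m y : l <= m -> U m y -> U l y.
Proof.
case: basisU => _ [Udecr _]; move=> /subnK<-; elim: (m - l) => // n IH.
by rewrite addSn => /Udecr/IH.
Qed.

(** Compactness again: a point other than [x0] lies outside some closed [U l], and so does a ball
    around it. *)
Lemma basis_shrinks eps : (0 < eps)%coqR -> exists m, forall y, U m y -> (d x0 y < eps)%coqR.
Proof.
move=> eps0; suff [m Hm] : exists m, forall y, True -> U m y -> (d x0 y < eps)%coqR.
  by exists m => y; apply: Hm.
apply: (cantor_compactness _ _ (fun A => exists m, forall y, A y -> U m y ->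
  (d x0 y < eps)%coqR) cantor).
- by move=> A B AB [m Hm]; exists m => y /AB; apply: Hm.
- move=> A B [m1 H1] [m2 H2]; exists (maxn m1 m2) => y [Ay|By] Uy.
    by apply: H1 => //; apply: basis_decr Uy; apply: leq_maxl.
  by apply: H2 => //; apply: basis_decr Uy; apply: leq_maxr.
move=> x; case: (classic (x = x0)) => [->|xx0].
  by exists eps; split=> //; exists 0.
have [l nUl] : exists l, ~ U l x.
  apply: NNPP => no; apply: xx0; case: basisU => _ [_ [_ /(_ x)[capU _]]].
  by apply: capU => l; apply: NNPP => nU; apply: no; exists l.
have [[_ clU] _] := basis_adapted l; have [e [e0 ball]] := clU x nUl.
by exists e; split=> //; exists l => y /ball.
Qed.

Lemma same_translate_near eps : (0 < eps)%coqR ->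
  exists m, forall x y, same_translate (U m) x y -> (d x y < eps)%coqR.
Proof.
move=> /equicont[delta [delta0 eq]].
have [|m Hm] := basis_shrinks (delta / 2)%coqR; first by lra.
exists m => x y [g [/Hm dx /Hm dy]]; rewrite -(actK g x) -(actK g y); apply: eq.
have := dist_triangle (Phi g x) x0 (Phi g y); rewrite (dist_sym _ x0); lra.
Qed.

(* The subgroup written [Gamma_(l,m)] at the top. *)
Definition germ_group (l m : nat) (g : G) :=
  forall y, U l y -> same_translate (U m) (Phi g y) y.

Lemma germ_group_subgroup l m : is_subgroup mul inv one (germ_group l m).
Proof.
have adm := basis_adapted m; split=> [y _|].
  by rewrite act1; apply: same_translate_refl.
split=> [a b ga gb y Uy|a ga y /ga gy].
  rewrite actM; apply: (same_translate_trans _ adm _ (Phi a y)); last exact: ga.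
  by apply: same_translate_act; apply: gb.
apply: same_translate_sym; rewrite -{1}(actK a y); exact: same_translate_act.
Qed.

Lemma germ_group_incr l l' m g : l <= l' -> germ_group l m g -> germ_group l' m g.
Proof. by move=> ll' gg y /(basis_decr _ _ _ ll')/gg. Qed.

Lemma germ_group_decr l m m' g : m <= m' -> germ_group l m' g -> germ_group l m g.
Proof.
by move=> mm' gg y /gg; apply: same_translate_sub => z; apply: basis_decr.
Qed.

Lemma germ_group_noetherian :
  virtually_fg_nilpotent mul inv one ->
  (exists L : list nat, forall p, in_prime_spectrum_of mul inv one Phi U p -> In p L) ->
  noetherian_on germ_group (fun _ => True).
Proof.
move=> [N [[sN [c lcs1]] [fgN [r indN]]]] [L HL].
(* [D] bounds the primes of the spectrum and also the index of [N], which enters on passing from [G]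
   to [N]. *)
pose D := maxn r (list_max L).
have L_D p : In p L -> p <= D.
  move=> Lp; apply: leq_trans (leq_maxr _ _); apply/leP.
  by have /list_max_le/Forall_forall := Nat.le_refl (list_max L); apply.
have stab_smooth m n : has_index mul inv one (stabilizer Phi (U m)) n -> smooth D n.
  move=> indn p pp /dvdnP[q eq]; apply/L_D/HL; split; first exact: prime_Zprime.
  by exists m, n; split=> //; exists q.
have F_smooth l m a : N a ->
    exists k, [/\ 0 < k, smooth D k & germ_group l m (gpow (mul := mul) (one := one) a k)].
  move=> Na; have [n indn] := stabilizer_finite_index _ (basis_adapted m).
  have [k [k0 sk Hk]] := smooth_exponent grp _ _ _ _ _ _ sN (stabilizer_subgroup (U m))
    lcs1 indN indn (leq_maxl _ _) (stab_smooth _ _ indn).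
  (* Lying in every conjugate of the stabilizer, [a^k] preserves each translate of [U m]. *)
  exists k; split=> // y _; have [g Ug] := adapted_reach _ (basis_adapted m) y.
  exists g; split=> //; have /stabilizerP/(_ (Phi g y))[/(_ Ug)] := Hk a (inv g) Na.
  by rewrite (ginvK grp) !actM actK.
have [s [_ [_ cover]]] := indN.
apply: (noetherian_on_layer grp _ germ_group_subgroup germ_group_incr germ_group_decr _ N).
  apply: (finite_layer grp _ germ_group_incr germ_group_decr _ _ s sN).
  by move=> g _; apply: cover.
exact: (noetherian_on_nilpotent grp _ germ_group_subgroup germ_group_incr germ_group_decr _ D sN _ c).
Qed.

Lemma closure_group_approx h m : closure_group d Phi h ->
  exists g, forall x, same_translate (U m) (h x) (Phi g x).
Proof.
have [delta [delta0 near]] := near_same_translate _ (basis_adapted m).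
by move=> [_ /(_ delta delta0)[g approx]]; exists g => x; apply/near/approx.
Qed.

Lemma noetherian_stable : noetherian_on germ_group (fun _ => True) -> stable_action d Phi.
Proof.
move=> [l0 noe]; have ad := basis_adapted.
have [eps [eps0 near]] := near_same_translate _ (ad l0).
(* A set of diameter below this [eps] lies in a single translate of [U l0]. *)
exists eps; split=> // A V opA _ [diam [diam_eps Adiam]] opV [v Vv] VA h1 h2 Gh1 Gh2 h12 u Au.
have [e [e0 ball]] := opV v Vv; have [m1 Hm1] := same_translate_near e e0.
(* The translate of [U l] around [v] must lie in [V], and [l0 <= l] is needed for the chain
   condition. *)
pose l := maxn m1 l0.
have V_in z : same_translate (U l) v z -> V z.
  move=> vz; apply/ball/Hm1; apply: same_translate_sub vz => x.
  by apply: basis_decr; apply: leq_maxl.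
have [g Ug] := adapted_reach _ (ad l) v.
have Ugu : U l0 (Phi g u).
  apply: (same_translate_in _ (ad l0) g v); last by apply: basis_decr Ug; apply: leq_maxr.
  by apply: near; have := Adiam v u (VA _ Vv) Au; lra.
apply: dist_small_eq => e' /same_translate_near[m Hm]; apply: Hm.
have [m' Hm'] := noe l m (leq_maxr _ _).
have [a1 H1] := closure_group_approx h1 (maxn m m') Gh1.
have [a2 H2] := closure_group_approx h2 (maxn m m') Gh2.
have near_m x y : same_translate (U (maxn m m')) x y -> same_translate (U m) x y.
  by apply: same_translate_sub => z; apply: basis_decr; apply: leq_maxl.
(* On the translate of [U l] inside [V] both maps agree, so their approximants [a1] and [a2] agree
   there up to level [m']; [g] carries this to [U l]. The chain condition extends it to [U l0],
   which contains [Phi g u]. *)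
have germ : germ_group l m' (g ** inv a2 ** a1 ** inv g).
  move=> y Uy; apply: (same_translate_sub (U (maxn m m'))).
    by move=> z; apply: basis_decr; apply: leq_maxr.
  have /h12 h12z : V (Phi (inv g) y) by apply: V_in; exists g; rewrite actVK.
  have := H1 (Phi (inv g) y); rewrite h12z => H1z.
  have := same_translate_trans _ (ad _) _ _ _ (same_translate_sym _ _ _ H1z) (H2 _).
  move=> /(same_translate_act _ (g ** inv a2)).
  by rewrite -!actM !gsimp act1.
have := same_translate_act _ (a2 ** inv g) _ _ (Hm' _ I germ _ Ugu).
rewrite -!actM !gsimp => Hu.
apply: (same_translate_trans _ (ad m) _ _ _ (near_m _ _ (H1 u))).
apply: (same_translate_trans _ (ad m) _ _ _ Hu).
exact: same_translate_sym (near_m _ _ (H2 u)).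
Qed.
End Basis.
End CantorAction.

Theorem theorem1p1 (X : Type) (d : X -> X -> R) (G : Type)
  (mul : G -> G -> G) (inv : G -> G) (one : G) (Phi : G -> X -> X) :
  nilpotent_cantor_action d mul inv one Phi ->
  finite_prime_spectrum d mul inv one Phi ->
  stable_action d Phi.
Proof.
move=> [act vnil] [x0 [U [basisU finspec]]].
exact: noetherian_stable act _ _ basisU (germ_group_noetherian act _ _ basisU vnil finspec).
Qed.
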